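(* Let $f$ and $g$ be partial Boolean functions. Then $\mathrm{RS}(f\circ g)\le\mathrm{RS}(f)\,\mathrm{R}_0(g)$. We also have $\mathrm{RS}(f\circ g)=O(\mathrm{RS}(f)\,\mathrm{R}(g)\log\mathrm{RS}(f))$.
   Context: A partial Boolean function on $n$ bits is $f:\mathrm{Dom}(f)\to\{0,1\}$ with $\mathrm{Dom}(f)\subseteq\{0,1\}^n$. For $f$ on $n$ bits and $g$ on $k$ bits, $f\circ g$ is the partial function on $nk$ bits with domain $\{(x_1,\dots,x_n):x_i\in\mathrm{Dom}(g),(g(x_1),\dots,g(x_n))\in\mathrm{Dom}(f)\}$ and value $f(g(x_1),\dots,g(x_n))$. A randomized query algorithm is a probability distribution over deterministic decision trees. $\mathrm{R}(h)$ is the minimum worst-case number of queries of a randomized algorithm correct with probability at least $2/3$ on every input in the domain of $h$. $\mathrm{R}_0(h)$ is the minimum, over randomized algorithms always correct on every input in the domain, of the maximum over inputs of the expected number of queries. Query notions apply to alphabet $\{0,1,*,\dagger\}$. Sabotage: $P_f\subseteq\{0,1,*\}^n$ is the set of $p$ for which there exist $x,y\in\mathrm{Dom}(f)$ with $f(x)\ne f(y)$ and $x_i=y_i=p_i$ whenever $p_i\ne*$; $P_f^\dagger$ is the same with $\dagger$ in place of $*$; $Q_f=P_f\cup P_f^\dagger$; $f_{\mathrm{sab}}:Q_f\to\{0,1\}$ is $0$ on $P_f$ and $1$ on $P_f^\dagger$; $\mathrm{RS}(f)=\mathrm{R}_0(f_{\mathrm{sab}})$ (and likewise for any partial Boolean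 function).
   Formalization: In the second bound the factor log RS(f) is read as max(1, log₂ RS(f)), with one universal constant; the literal bound fails when RS(f)=1 (e.g. f and g the identity on one bit), where log RS(f)=0 but RS(f∘g)=1. *)

(* Defs.v *)
From HB Require Import structures.
From mathcomp Require Import all_boot all_order all_algebra.
From mathcomp Require Import all_classical all_reals all_analysis.

Set Implicit Arguments.
Unset Strict Implicit.
Unset Printing Implicit Defensive.

Import Order.TTheory GRing.Theory Num.Theory.

Local Open Scope classical_set_scope.
Local Open Scope ring_scope.

Notation word S n := {ffun 'I_n -> S}.

(* [h x = None] means that [x] lies outside the domain of [h]. *)
Definition pfun (S : finType) (n : nat) := word S n -> option bool.

Definition dom (S : finType) n (h : pfun S n) : {set word S n} :=
  [set x | h x != None]%SET.

(* [mxvec_index : 'I_n -> 'I_k -> 'I_(n * k)] is the library's bijection between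
   pairs (block, position inside the block) and positions. *)
Definition block (S : finType) n k (z : word S (n * k)) (i : 'I_n) : word S k :=
  [ffun j => z (mxvec_index i j)].

Definition pf_comp n k (f : pfun bool n) (g : pfun bool k) : pfun bool (n * k) :=
  fun z =>
    if [forall i : 'I_n, block z i \in dom g]
    then f [ffun i => odflt false (g (block z i))]
    else None.

Inductive symbol := Bit of bool | Star | Dagger.

Definition symbol_code (s : symbol) : bool + bool :=
  match s with Bit b => inl b | Star => inr false | Dagger => inr true end.

Definition symbol_decode (c : bool + bool) : symbol :=
  match c with inl b => Bit b | inr false => Star | inr true => Dagger end.

Lemma symbol_codeK : cancel symbol_code symbol_decode.
Proof. by case. Qed.

HB.instance Definition _ := Finite.copy symbol (can_type symbol_codeK).

(* [sab_set Star f] is P_f and [sab_set Dagger f] is P_f^dagger.  The condition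
   forces every entry of [p] to be a bit or [s]. *)
Definition sab_set (s : symbol) n (f : pfun bool n) : {set word symbol n} :=
  [set p : word symbol n |
    [exists x in dom f, exists y in dom f, (f x != f y) &&
      [forall i, (p i != s) ==> (p i == Bit (x i)) && (p i == Bit (y i))]]]%SET.

(* The two tests are exclusive: words in both sets would contain only bits, and
   would force x = y. *)
Definition sab n (f : pfun bool n) : pfun symbol n :=
  fun p => if p \in sab_set Star f then Some false
           else if p \in sab_set Dagger f then Some true
           else None.

Inductive dtree (S : Type) (n : nat) :=
| Leaf of bool
| Query of 'I_n & (S -> dtree S n).
Arguments Leaf {S n} _.
Arguments Query {S n} _ _.

Fixpoint output (S : finType) n (t : dtree S n) (x : word S n) : bool :=
  match t with
  | Leaf b => b
  | Query i k => output (k (x i)) x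
  end.

Fixpoint queries (S : finType) n (t : dtree S n) (x : word S n) : nat :=
  match t with
  | Leaf _ => 0%N
  | Query i k => (queries (k (x i)) x).+1
  end.

(* Deterministic decision trees over a finite alphabet form a countable set,
   which carries the discrete sigma-algebra. *)
HB.instance Definition _ (S : finType) n := gen_eqMixin (dtree S n).
HB.instance Definition _ (S : finType) n := gen_choiceMixin (dtree S n).
HB.instance Definition _ (S : finType) n :=
  isPointed.Build (dtree S n) (Leaf false).
HB.instance Definition _ (S : finType) n :=
  @isMeasurable.Build default_measure_display (dtree S n)
    (@discrete_measurable (dtree S n))
    (@discrete_measurable0 (dtree S n))
    (@discrete_measurableC (dtree S n))
    (@discrete_measurableU (dtree S n)).

Definition ralg (R : realType) (S : finType) (n : nat) :=
  probability (dtree S n) R.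

Section Complexity.
Variables (R : realType) (S : finType) (n : nat).
Implicit Types (A : ralg R S n) (h : pfun S n).

Definition correct_with (p : R) A h : Prop :=
  forall x b, h x = Some b -> (p%:E <= A [set t | output t x = b])%E.

Definition worst_case_le A h (d : nat) : Prop :=
  forall x, x \in dom h -> A [set t | (queries t x <= d)%N] = 1%E.

Definition expected_queries A (x : word S n) : \bar R :=
  'E_A[fun t => (queries t x)%:R]%E.

(* The value is 0 when the domain is empty. *)
Definition max_expected_queries A h : \bar R :=
  \big[Order.max/0%E]_(x in dom h) expected_queries A x.

(* In both definitions below the infimum is attained: it ranges over naturals in
   the first one; in the second one, finitely many trees suffice because no
   tree needs to query the same position twice. *)
Definition Rand h : R :=
  inf [set d%:R | d in [set d : nat | exists A : ralg R S n,
                          correct_with (2 / 3) A h /\ worst_case_le A h d]].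

Definition Rand0 h : R :=
  fine (ereal_inf [set max_expected_queries A h | A in
                     [set A : ralg R S n | correct_with 1 A h]]).

End Complexity.

Definition RS (R : realType) n (f : pfun bool n) : R := Rand0 R (sab f).

Definition log2 (R : realType) (x : R) : R := ln x / ln 2.

(* Main.v *)
(* An algorithm [A] for the sabotaged [f] is simulated on a sabotaged input of
   [f o g]: a query of bit i is answered by running an algorithm [B] for [g] on the
   i-th block, and the simulation stops when a sabotaged entry shows up.  Let x, y
   be the two inputs of [f o g] behind the sabotaged input.  If [B] is right on
   the i-th blocks of x and y, then either their values agree and the simulated
   answer is that value, or they differ, hence [B] separates the two blocks and
   must hit a sabotaged entry.  So [A] behaves as on the sabotaged input of [f]
   built from the two words of [g]-values, where it too must meet a sabotaged
   entry.  One draw of [B] serves all blocks: only linearity of expectation (and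
   a union bound, below) is used.

   For the second bound, [A] is cut after T = O(RS f) queries and [B] is a
   majority vote of O(log T) runs of a bounded-error algorithm, so that by Markov's
   inequality and a union bound the simulation fails with probability at most 1/2.
   On failure an arbitrary zero-error algorithm [E] for the sabotaged [f o g] takes
   over; letting the cost of [E] tend to its infimum gives
   RS(f o g) <= T D + RS(f o g) / 2 where D is the cost of the vote. *)

From HB Require Import structures.
Require Import Defs.
From mathcomp Require Import all_boot all_order all_algebra.
From mathcomp Require Import all_classical all_reals all_analysis giry.
From mathcomp Require Import ring lra zify.

Set Implicit Arguments.
Unset Strict Implicit.
Unset Printing Implicit Defensive.
Import Order.TTheory GRing.Theory Num.Theory.
Local Open Scope classical_set_scope.
Local Open Scope ring_scope.

(** * Expectations over random decision trees *)

Section ProbabilityOnTrees.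
Variables (R : realType) (S : finType) (n : nat).
Implicit Types (A : ralg R S n) (F G : dtree S n -> \bar R).

(** The sigma-algebra on trees is discrete, so the integrals below carry no measurability
    conditions. *)
Lemma measurable_dtree d (T : measurableType d) (D : set (dtree S n))
  (F : dtree S n -> T) : measurable_fun D F.
Proof. by []. Qed.

Definition mean A F : \bar R := (\int[A]_t F t)%E.

Lemma mean_cst A (c : \bar R) : mean A (fun=> c) = c.
Proof.
transitivity (c * A setT)%E; first exact: integral_cst.
by rewrite (_ : A setT = 1%E) ?mule1//; exact: probability_setT.
Qed.

Lemma eq_mean A F G : F =1 G -> mean A F = mean A G.
Proof. by move=> FG; apply: eq_integral => t _. Qed.

Lemma mean_ge0 A F : (forall t, 0 <= F t)%E -> (0 <= mean A F)%E.
Proof. by move=> F0; apply: integral_ge0. Qed.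

Lemma le_mean A F G : (forall t, 0 <= F t)%E -> (forall t, F t <= G t)%E ->
  (mean A F <= mean A G)%E.
Proof. by move=> F0 FG; apply: ge0_le_integral. Qed.

Lemma meanD A F G : (forall t, 0 <= F t)%E -> (forall t, 0 <= G t)%E ->
  mean A (fun t => F t + G t)%E = (mean A F + mean A G)%E.
Proof. by move=> F0 G0; apply: ge0_integralD. Qed.

Lemma meanZl A F (c : \bar R) : (0 <= c)%E -> (forall t, 0 <= F t)%E ->
  mean A (fun t => c * F t)%E = (c * mean A F)%E.
Proof. by move=> c0 F0; apply: ge0_integralZl. Qed.

Lemma meanZr A F (c : \bar R) : (0 <= c)%E -> (forall t, 0 <= F t)%E ->
  mean A (fun t => F t * c)%E = (mean A F * c)%E.
Proof.
move=> c0 F0; rewrite muleC -meanZl//.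
by apply: eq_mean => t; rewrite muleC.
Qed.

Lemma mean_prob A (P : pred (dtree S n)) :
  mean A (fun t => (P t)%:R%:E) = A [set t | P t].
Proof.
transitivity (A ([set t | P t] `&` setT)); last by rewrite setIT.
rewrite -[RHS]integral_indic//.
apply: eq_integral => t _; rewrite indicE; congr ((nat_of_bool _)%:R%:E).
by apply/idP/idP => [/mem_set|/set_mem].
Qed.

Lemma expected_queriesE A x :
  expected_queries A x = mean A (fun t => (queries t x)%:R%:E).
Proof. by rewrite /expected_queries unlock. Qed.

Lemma mean_probC A (P : pred (dtree S n)) :
  (mean A (fun t => (P t)%:R%:E) + mean A (fun t => (~~ P t)%:R%:E) = 1)%E.
Proof.
rewrite -meanD => [||t]; rewrite ?lee_fin//.
rewrite -[RHS](mean_cst A); apply: eq_mean => t.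
by case: (P t); rewrite /= ?adde0 ?add0e.
Qed.

Lemma mean_sureC A (P : pred (dtree S n)) :
  mean A (fun t => (P t)%:R%:E) = 1%E <-> mean A (fun t => (~~ P t)%:R%:E) = 0%E.
Proof.
have H := mean_probC A P; split => h; rewrite h in H; last by rewrite adde0 in H.
by case: (mean _ _) H => //= r [] r1; congr _%:E; lra.
Qed.

Lemma mean_le_sure A (P Q : pred (dtree S n)) :
  mean A (fun t => (Q t)%:R%:E) = 1%E ->
  (mean A (fun t => (P t)%:R%:E) <= mean A (fun t => (P t && Q t)%:R%:E))%E.
Proof.
move=> /mean_sureC Q0; rewrite -[leRHS]adde0 -Q0 -meanD => [||t]; rewrite ?lee_fin//.
apply: le_mean => t; first by rewrite lee_fin.
by rewrite -EFinD -natrD lee_fin ler_nat; case: (P t); case: (Q t).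
Qed.

End ProbabilityOnTrees.

(** * Sequential composition of random draws, by the Giry monad *)

Section Bind.
Variables (R : realType) (S S' : finType) (n n' : nat) (A : ralg R S n).
Variable K : dtree S n -> ralg R S' n'.

Definition bind_measure : set (dtree S' n') -> \bar R :=
  giry_bind (A : giry _ R)
    (@measurable_dtree _ _ _ _ setT (K : dtree S n -> giry _ R)).

HB.instance Definition _ := Measure.on bind_measure.

Let integral_bind (F : dtree S' n' -> \bar R) : (forall t, 0 <= F t)%E ->
  (\int[bind_measure]_t F t)%E = mean A (fun a => mean (K a) F).
Proof. by move=> F0; apply: giry_int_bind. Qed.

Let bind_setT : bind_measure setT = 1%E.
Proof.
have := integral_bind (F := cst 1%E) (fun=> lee01).
rewrite integral_cst//= mul1e => ->.
by rewrite -[RHS](mean_cst A); apply: eq_mean => a; exact: mean_cst.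
Qed.

HB.instance Definition _ :=
  Measure_isProbability.Build _ _ _ bind_measure bind_setT.

Definition rbind : ralg R S' n' := bind_measure.

Lemma mean_bind (F : dtree S' n' -> \bar R) : (forall t, 0 <= F t)%E ->
  mean rbind F = mean A (fun a => mean (K a) F).
Proof. exact: integral_bind. Qed.

End Bind.

Definition rret (R : realType) (S : finType) n (t : dtree S n) : ralg R S n := \d_t.

Lemma mean_ret (R : realType) (S : finType) n (t : dtree S n) F :
  mean (rret R t) F = F t.
Proof. by rewrite /mean integral_dirac// diracT mul1e. Qed.

(** * Truncation, path costs and grafting of decision trees *)

Section DecisionTrees.
Variables (S : finType) (n : nat).
Implicit Types (t : dtree S n) (x : word S n).

Fixpoint trunc d t : dtree S n :=
  match t, d with
  | Leaf b, _ => Leaf b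
  | Query i c, d'.+1 => Query i (fun s => trunc d' (c s))
  | Query _ _, 0 => Leaf false
  end.

Lemma queries_trunc d t x : (queries (trunc d t) x <= d)%N.
Proof. by elim: t d => [b|i c IH] [|d] //=; rewrite ltnS. Qed.

Lemma output_trunc d t x :
  (queries t x <= d)%N -> output (trunc d t) x = output t x.
Proof. by elim: t d => [b|i c IH] [|d] //=; rewrite ltnS => /IH. Qed.

(** The cost of [t] on [x] when a query of [i] is replaced by a subroutine charged [w i]. With error
    counts for [w], positivity signals a faulty call, which leads to a union bound. *)
Fixpoint path_sum t x (w : 'I_n -> nat) : nat :=
  match t with
  | Leaf _ => 0
  | Query i c => w i + path_sum (c (x i)) x w
  end.

Fixpoint read_word (l : seq 'I_n) (w : word S n) (h : pfun S n) : dtree S n :=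
  match l with
  | [::] => Leaf (odflt false (h w))
  | i :: l' => Query i (fun s => read_word l' [ffun j => if j == i then s else w j] h)
  end.

(** Supplies the trivial algorithm that reads the whole word; [s0] only fills positions not yet
    read. *)
Lemma read_wordP (s0 : S) (h : pfun S n) : exists t, forall x,
  queries t x = n /\ forall b, h x = Some b -> output t x = b.
Proof.
have H (l : seq 'I_n) w x : queries (read_word l w h) x = size l /\
    output (read_word l w h) x =
    odflt false (h [ffun j => if j \in l then x j else w j]).
  elim: l w => [|i l IH] w /=.
    by split=> //; congr (odflt _ (h _)); apply/ffunP => j; rewrite ffunE.
  case: (IH [ffun j => if j == i then x i else w j]) => -> ->; split => //.
  congr (odflt _ (h _)); apply/ffunP => j; rewrite !ffunE inE.
  by have [->|] := eqVneq j i; case: ifP.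
exists (read_word (enum 'I_n) [ffun=> s0] h) => x.
have [-> ->] := H (enum 'I_n) [ffun=> s0] x; rewrite size_enum_ord; split => // b hb.
rewrite (_ : [ffun _ => _] = x) ?hb//.
by apply/ffunP => j; rewrite ffunE mem_enum.
Qed.

Fixpoint graft t (k : bool -> dtree S n) : dtree S n :=
  match t with
  | Leaf b => k b
  | Query i c => Query i (fun s => graft (c s) k)
  end.

Lemma output_graft t k x : output (graft t k) x = output (k (output t x)) x.
Proof. by elim: t => //= i c IH; rewrite IH. Qed.

Lemma queries_graft t k x :
  queries (graft t k) x = (queries t x + queries (k (output t x)) x)%N.
Proof. by elim: t => //= i c IH; rewrite IH. Qed.

End DecisionTrees.

(** * Sabotaged words and their witnesses *)

Definition sab_sym (b : bool) : symbol := if b then Dagger else Star.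

Definition sabotaged n (x y : word bool n) (b : bool) (p : word symbol n) :=
  forall i, p i = sab_sym b \/ p i = Bit (x i) /\ x i = y i.

(** Only positions where [x] and [y] differ are sabotaged, so a tree that meets none of them cannot
    tell the two values of [b] apart. *)
Definition sab_merge n (x y : word bool n) (b : bool) : word symbol n :=
  [ffun i => if x i == y i then Bit (x i) else sab_sym b].

Lemma sab_witness n (h : pfun bool n) p b : sab h p = Some b ->
  exists x y, [/\ x \in dom h, y \in dom h, h x != h y & sabotaged x y b p].
Proof.
have H b' : p \in sab_set (sab_sym b') h ->
    exists x y, [/\ x \in dom h, y \in dom h, h x != h y & sabotaged x y b' p].
  rewrite inE => /existsP[x /andP[hx /existsP[y /and3P[hy hxy /forallP hp]]]].
  exists x, y; split => // i; have /implyP := hp i.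
  case: eqVneq => [->|_ /(_ isT)]; first by left.
  by move=> /andP[/eqP px /eqP]; rewrite px => -[]; right.
rewrite /sab; case: ifP => [/(H false) ? [<-]//|_].
by case: ifP => // /(H true) ? [<-].
Qed.

Lemma sab_mergeP n (h : pfun bool n) x y b :
  x \in dom h -> y \in dom h -> h x != h y -> sab h (sab_merge x y b) = Some b.
Proof.
move=> hx hy hxy.
have H b' : sab_merge x y b' \in sab_set (sab_sym b') h.
  rewrite inE; apply/existsP; exists x; rewrite hx /=.
  apply/existsP; exists y; rewrite hy hxy /=.
  apply/forallP => i; apply/implyP; rewrite ffunE.
  by case: (eqVneq (x i)) => [->|]; rewrite eqxx.
rewrite /sab; case: b; last by rewrite H.
(* For [b = true] the word must also lie outside [sab_set Star]: it holds a [Dagger] at some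
   position, since [x] and [y] differ. *)
rewrite (H true) ifN// inE; apply/existsP => -[x' /andP[_ /existsP[y']]].
case/and3P => _ _ /forallP hp.
suff [i xyi] : exists i, x i != y i.
  by move: (hp i); rewrite ffunE (negPf xyi).
apply/existsP; apply: contraR hxy => /existsPn xy.
by rewrite (_ : x = y)//; apply/ffunP => i; apply/eqP/negPn.
Qed.

(** * Simulating a sabotage algorithm on a composed input *)

Section Simulation.
Variables n k : nat.
Implicit Types (t : dtree bool k) (e : dtree symbol (n * k)).

(* On a sabotaged entry the simulation stops with the answer it reveals. *)
Fixpoint run_block (i : 'I_n) t (c : bool -> dtree symbol (n * k)) :=
  match t with
  | Leaf o => c o
  | Query j u => Query (mxvec_index i j) (fun s => match s with
                   | Bit v => run_block i (u v) c
                   | Star => Leaf false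
                   | Dagger => Leaf true
                   end)
  end.

(** Only bits are ever fed to [a], so reaching one of its leaves means that no sabotaged entry was
    found; its answer is then discarded in favour of [e]. *)
Fixpoint simulate (a : dtree symbol n) t e : dtree symbol (n * k) :=
  match a with
  | Leaf _ => e
  | Query i c => run_block i t (fun o => simulate (c (Bit o)) t e)
  end.

Section FixedInput.
Variables (x y : word bool (n * k)) (b : bool) (p : word symbol (n * k)).
Hypothesis p_sab : sabotaged x y b p.

(** Until a sabotaged entry is met, every entry read is common to [x] and [y], so [t] follows the
    same path on both blocks. *)
Lemma run_blockP i t c :
  output (run_block i t c) p = b /\
    (queries (run_block i t c) p <= queries t (block x i))%N \/
  [/\ output t (block x i) = output t (block y i),
      output (run_block i t c) p = output (c (output t (block x i))) p &
      queries (run_block i t c) p =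
        (queries t (block x i) + queries (c (output t (block x i))) p)%N].
Proof.
elim: t => [r|j u IH] /=; first by right.
rewrite !ffunE; have [->|[-> <-]] := p_sab (mxvec_index i j).
  by left; case: b.
have [[-> ?]|[-> -> ->]] := IH (x (mxvec_index i j)); first by left.
by right.
Qed.

Variables X Y : word bool n.

Definition misread t (i : 'I_n) : nat :=
  (output t (block x i) != X i) + (output t (block y i) != Y i).

(** When no sabotaged entry is met, each answer fed to [a] is common to both sides. If all are
    right, they are entries of both merged words, and [trunc T a] ends in the same leaf on both;
    otherwise the first misread call lies on the path and makes the sum positive. *)
Lemma simulate_trunc T D a t e (t' := trunc D t) (s := simulate (trunc T a) t' e) :
  output s p = b /\ (queries s p <= T * D)%N \/
  [/\ output s p = output e p, (queries s p <= T * D + queries e p)%N &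
    (0 < path_sum (trunc T a) (sab_merge X Y b) (misread t'))%N \/
    output (trunc T a) (sab_merge X Y true) =
      output (trunc T a) (sab_merge X Y false)].
Proof.
rewrite {}/s; elim: T a => [|T IH] [r|i c] /=;
  try by right; split => //; right.
  by right; split => //; [exact: leq_addl|right].
have [[-> q1]|[xy oc qc]] := run_blockP i t' (fun o => simulate (trunc T (c (Bit o))) t' e).
  left; split => //; apply: (leq_trans q1); apply: (leq_trans (queries_trunc _ _ _)).
  by rewrite mulSn leq_addr.
rewrite oc qc; have qt : (queries t' (block x i) <= D)%N := queries_trunc _ _ _.
have [[-> q1]|[-> q1 bad]] := IH (c (Bit (output t' (block x i)))).
  by left; split => //; lia.
right; split => //; first lia.
have [w|] := posnP (misread t' i); last by left; lia.
move: w bad; rewrite {1}/misread => /eqP.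
rewrite addn_eq0 !eqb0 !negbK => /andP[/eqP oX /eqP oY].
have XY : X i = Y i by rewrite -oX -oY.
rewrite !ffunE XY eqxx -XY oX => -[bad|bad]; last by right.
by left; lia.
Qed.

(** Without misreadings, a run that met no sabotaged entry would reach one leaf of [a] on both
    merged words, against the second premise; so [e] is never reached. *)
Lemma simulateP a t e :
  (forall i, misread t i = 0%N) ->
  output a (sab_merge X Y true) != output a (sab_merge X Y false) ->
  output (simulate a t e) p = b /\
  (queries (simulate a t e) p <=
     path_sum a (sab_merge X Y b) (fun i => queries t (block x i)))%N.
Proof.
move=> good; elim: a => [r|i c IH] /=; first by rewrite eqxx.
have /eqP := good i; rewrite addn_eq0 !eqb0 !negbK => /andP[/eqP oX /eqP oY].
have [[-> q1] _|[xy -> ->]] := run_blockP i t (fun o => simulate (c (Bit o)) t e).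
  by split => //; lia.
have XY : X i = Y i by rewrite -oX -oY.
rewrite !ffunE XY eqxx -XY oX => /IH[-> ?]; split => //; lia.
Qed.

End FixedInput.
End Simulation.

(** * Zero-error trees, near-optimal algorithms and trivial lower bounds *)

Definition solves (S : finType) n (h : pfun S n) (t : dtree S n) : bool :=
  [forall x, [forall b, (h x == Some b) ==> (output t x == b)]].

Lemma solvesP (S : finType) n (h : pfun S n) t :
  reflect (forall x b, h x = Some b -> output t x = b) (solves h t).
Proof.
apply: (iffP forallP) => [H x b /eqP hx|H x].
  by have /forallP/(_ b) := H x; rewrite hx => /eqP.
by apply/forallP => b; apply/implyP => /eqP /H ->.
Qed.

Section Complexity.
Variables (R : realType) (S : finType) (n : nat).
Implicit Types (A : ralg R S n) (h : pfun S n).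

Lemma mean_bool_le1 A (P : pred (dtree S n)) :
  (mean A (fun t => (P t)%:R%:E) <= 1)%E.
Proof.
rewrite -[leRHS](mean_cst A); apply: le_mean => t; rewrite lee_fin ?ler0n//.
by case: (P t).
Qed.

Lemma mean_sure_all A (I : finType) (P : I -> pred (dtree S n)) :
  (forall i, mean A (fun t => (P i t)%:R%:E) = 1%E) ->
  mean A (fun t => [forall i, P i t]%:R%:E) = 1%E.
Proof.
move=> P1.
have {}P1 : mean A (fun t => (all (P^~ t) (enum I))%:R%:E) = 1%E.
  elim: (enum I) => [|i l IH] /=; first exact: mean_cst.
  apply/eqP; rewrite eq_le mean_bool_le1 -(P1 i).
  exact: (mean_le_sure (P i) IH).
rewrite -P1; apply: eq_mean => t; congr ((nat_of_bool _)%:R%:E).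
apply/forallP/allP => [H i _|H i]; first exact: H.
by apply: H; rewrite mem_enum.
Qed.

Lemma correct_withE (q : R) A h :
  correct_with q A h <-> forall x b, h x = Some b ->
    (q%:E <= mean A (fun t => (output t x == b)%:R%:E))%E.
Proof.
have E x b : mean A (fun t => (output t x == b)%:R%:E) =
    A [set t | output t x = b].
  rewrite mean_prob; congr (Probability.sort A _).
  by apply/seteqP; split => t /= /eqP.
by split=> H x b hx; have := H x b hx; rewrite E.
Qed.

(** There are finitely many inputs, so being almost surely right on each of them is being almost
    surely right on all at once. *)
Lemma correct_with1 A h :
  correct_with 1 A h <-> mean A (fun t => (solves h t)%:R%:E) = 1%E.
Proof.
rewrite correct_withE; split => [H|H x b hx].
  apply: mean_sure_all => x; apply: mean_sure_all => b.
  have [/H Hx|hx] := eqVneq (h x) (Some b); last exact: (mean_cst A 1%E).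
  by apply/eqP; rewrite eq_le mean_bool_le1.
rewrite -H; apply: le_mean => t; rewrite ?lee_fin// ler_nat.
by case: solvesP => // /(_ _ _ hx) ->; rewrite eqxx.
Qed.

Lemma max_expected_queries_ge0 A h : (0 <= max_expected_queries A h)%E.
Proof. by rewrite /max_expected_queries; apply: bigmax_ge_id. Qed.

Let costs h := [set max_expected_queries A h | A in
                     [set A : ralg R S n | correct_with 1 A h]].

Let costs_ge0 h : (0 <= ereal_inf (costs h))%E.
Proof. by apply: le_ereal_inf_tmp => _ [A _ <-]; exact: max_expected_queries_ge0. Qed.

Lemma Rand0_ge0 h : 0 <= Rand0 R h.
Proof. exact: fine_ge0 (costs_ge0 h). Qed.

Lemma Rand0_le A h (c : R) : correct_with 1 A h -> 0 <= c ->
  (forall x, x \in dom h -> (expected_queries A x <= c%:E)%E) -> Rand0 R h <= c.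
Proof.
move=> Ah c0 Ac.
have H : (ereal_inf (costs h) <= c%:E)%E.
  apply: (@le_trans _ _ (max_expected_queries A h)).
    by apply: ereal_inf_lbound; exists A.
  by apply: bigmax_le => //; rewrite lee_fin.
rewrite -lee_fin fineK ?ge0_fin_numE ?costs_ge0//.
by apply: le_lt_trans H _; exact: ltry.
Qed.

Variable s0 : S.

Lemma exact_alg h : exists A, correct_with 1 A h /\
  forall x, A [set t | (queries t x <= n)%N] = 1%E /\ expected_queries A x = n%:R%:E.
Proof.
have [t ht] := read_wordP s0 h; exists (rret R t); split.
  apply/correct_with1; rewrite mean_ret.
  by rewrite (_ : solves h t = true)//; apply/solvesP => x b; have [_] := ht x; apply.
move=> x; have [qx _] := ht x; split; last by rewrite expected_queriesE mean_ret qx.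
by rewrite -mean_prob mean_ret qx leqnn.
Qed.

Lemma Rand0_attain h (e : R) : 0 < e -> exists A, correct_with 1 A h /\
  forall x, x \in dom h -> (expected_queries A x <= (Rand0 R h + e)%:E)%E.
Proof.
move=> e0.
have fin : ereal_inf (costs h) \is a fin_num.
  have [A [Ah Aq]] := exact_alg h; rewrite ge0_fin_numE//.
  apply: (@le_lt_trans _ _ n%:R%:E); last exact: ltry.
  apply: (@le_trans _ _ (max_expected_queries A h)).
    by apply: ereal_inf_lbound; exists A.
  apply: bigmax_le => [|x _]; first by rewrite lee_fin.
  by have [_ ->] := Aq x.
have [_ [A Ah <-] Ae] := lb_ereal_inf_adherent e0 fin.
exists A; split => // x hx; rewrite EFinD /Rand0 fineK//.
apply: le_trans (ltW Ae); exact: (@le_bigmax_cond _ _ _ _ _ (fun x => x \in dom h)).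
Qed.

Let depths h := [set (d%:R : R) | d in [set d : nat | exists A : ralg R S n,
                          correct_with (2 / 3) A h /\ worst_case_le A h d]].

Lemma has_inf_depths h : has_inf (depths h).
Proof.
split; last by exists 0 => _ [d _ <-].
have [A [Ah Aq]] := exact_alg h; exists n%:R, n => //; exists A; split.
  by move=> x b /Ah; apply: le_trans; rewrite lee_fin; lra.
by move=> x _; have [] := Aq x.
Qed.

Lemma Rand_ge0 h : 0 <= Rand R h.
Proof. by apply: lb_le_inf; [case: (has_inf_depths h)|move=> _ [d _ <-]]. Qed.

Lemma Rand_attain h (e : R) : 0 < e -> exists d A,
  [/\ correct_with (2 / 3) A h, worst_case_le A h d & d%:R <= Rand R h + e].
Proof.
move=> e0; have [_ [d [A [Ah Ad]] <-] dlt] := inf_adherent e0 (has_inf_depths h).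
by exists d, A; split => //; exact: ltW.
Qed.

Lemma Rand_ge1 h x y : x \in dom h -> y \in dom h -> h x != h y -> 1 <= Rand R h.
Proof.
move=> hx hy hxy; apply: lb_le_inf; first by case: (has_inf_depths h).
move=> _ [[|d] [A [Ah Ad]] <-]; last by rewrite ler1n.
move: hx hy hxy; rewrite !inE.
case hx: (h x) => [b|//] _; case hy: (h y) => [b'|//] _ bb'.
have q0 : mean A (fun t => (queries t x <= 0)%N%:R%:E) = 1%E.
  by rewrite mean_prob; apply: Ad; rewrite inE hx.
have /correct_withE cA := Ah.
(* The two success probabilities add up to at least 4/3, but a tree that makes no query on [x] is a
   leaf, whose constant answer is right on at most one of [x] and [y]. *)
have := leeD (le_trans (cA _ _ hx) (mean_le_sure _ q0)) (cA _ _ hy).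
rewrite -meanD => [||t]; rewrite ?lee_fin//.
apply: contraPT => _; apply/negP; rewrite -ltNge.
apply: (@le_lt_trans _ _ 1%E); last by rewrite -EFinD lte_fin; lra.
rewrite -[leRHS](mean_cst A); apply: le_mean => t.
  by rewrite adde_ge0// lee_fin.
rewrite -EFinD -natrD lee_fin -[leRHS]/(1%:R) ler_nat.
case: t => [v|i u]; last by rewrite /= andbF; case: eqP.
rewrite /= andbT; case: eqVneq => [->|_]; last by case: eqP.
by move: bb'; rewrite (inj_eq Some_inj) => /negPf ->.
Qed.

End Complexity.

(** A leaf cannot separate the [Star] and [Dagger] merges of [x] and [y], so a solving tree makes at
    least one query. *)
Lemma sab_lower_bound (R : realType) n (f : pfun bool n) x y :
  x \in dom f -> y \in dom f -> f x != f y -> 1 <= RS R f.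
Proof.
move=> fx fy fxy; apply/ler_addgt0Pr => e e0.
have [A [/correct_with1 Ah Aq]] := Rand0_attain Star (sab f) e0.
have sq b := sab_mergeP b fx fy fxy.
have := Aq (sab_merge x y true); rewrite inE sq => /(_ isT).
rewrite expected_queriesE => /(le_trans _) H; rewrite -lee_fin; apply: H.
rewrite -Ah; apply: le_mean => t; first by rewrite lee_fin.
rewrite lee_fin ler_nat; case: solvesP => // st.
have := st _ _ (sq true); have := st _ _ (sq false).
by case: t {st} => [r|i u] //= -> .
Qed.

Lemma pf_comp_dom n k (f : pfun bool n) (g : pfun bool k) z :
  z \in dom (pf_comp f g) ->
  exists X : word bool n, [/\ forall i, g (block z i) = Some (X i), X \in dom f &
    pf_comp f g z = f X].
Proof.
rewrite inE /pf_comp; case: ifP => // /forallP gz fX.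
exists [ffun i => odflt false (g (block z i))]; split; rewrite ?inE// => i.
by have := gz i; rewrite inE ffunE; case: (g _).
Qed.

Lemma sab_comp_witness n k (f : pfun bool n) (g : pfun bool k) p b :
  sab (pf_comp f g) p = Some b ->
  exists x y (X Y : word bool n), [/\ sabotaged x y b p,
    forall i, g (block x i) = Some (X i), forall i, g (block y i) = Some (Y i) &
    [/\ X \in dom f, Y \in dom f & f X != f Y]].
Proof.
move=> /sab_witness[x [y [/pf_comp_dom[X [gX fX ->]] /pf_comp_dom[Y [gY fY ->]] fXY xyp]]].
by exists x, y, X, Y.
Qed.

(** The path is fixed by [t] and [x], independently of [u], so linearity applies although one draw
    [u] serves every query. *)
Lemma mean_path_sum (R : realType) (S S' : finType) n n' (B : ralg R S' n')
    (t : dtree S n) x (w : dtree S' n' -> 'I_n -> nat) (c : R) :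
  (forall i, (mean B (fun u => (w u i)%:R%:E) <= c%:E)%E) ->
  (mean B (fun u => (path_sum t x (w u))%:R%:E) <= (queries t x)%:R%:E * c%:E)%E.
Proof.
move=> wc; elim: t => [r|i u IH] /=; first by rewrite mean_cst mul0e.
under (@eq_mean _ _ _ B) => v do rewrite natrD EFinD.
rewrite meanD => [||v]; rewrite ?lee_fin//.
rewrite -add1n natrD EFinD ge0_muleDl ?lee_fin// mul1e.
exact: leeD (wc i) (IH (x i)).
Qed.

Lemma mean_bind_ret (R : realType) (S1 S2 S3 : finType) n1 n2 n3
    (A : ralg R S1 n1) (B : ralg R S2 n2) (F : dtree S1 n1 -> dtree S2 n2 -> dtree S3 n3)
    (G : dtree S3 n3 -> \bar R) : (forall t, 0 <= G t)%E ->
  mean (rbind A (fun a => rbind B (fun b => rret R (F a b)))) G =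
  mean A (fun a => mean B (fun b => G (F a b))).
Proof.
move=> G0; rewrite mean_bind//; apply: eq_mean => a.
by rewrite mean_bind//; apply: eq_mean => b; rewrite mean_ret.
Qed.

(** * Composition with a zero-error inner algorithm *)

Section ZeroError.
Variables (R : realType) (n k : nat) (f : pfun bool n) (g : pfun bool k).

(** Under zero-error algorithms the guard fails with probability zero; the leaf put there makes the
    query bound hold for every pair of trees. *)
Definition guarded_simulate a b : dtree symbol (n * k) :=
  if solves (sab f) a && solves g b then simulate a b (Leaf false) else Leaf false.

(** The words [x] and [q] depend on [p] alone, so the bound can be averaged over [b] and then over
    [a]. *)
Lemma guarded_simulateP p c : sab (pf_comp f g) p = Some c ->
  exists x q, [/\ forall i, block x i \in dom g, q \in dom (sab f) &
    forall a b,
    (solves (sab f) a -> solves g b -> output (guarded_simulate a b) p = c) /\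
    (queries (guarded_simulate a b) p <=
       path_sum a q (fun i => queries b (block x i)))%N].
Proof.
move=> /sab_comp_witness[x [y [X [Y [xyp gX gY [fX fY fXY]]]]]].
exists x, (sab_merge X Y c); split => [i||a b].
- by rewrite inE gX.
- by rewrite inE sab_mergeP.
rewrite /guarded_simulate; case: solvesP => //= sa; case: solvesP => //= sb.
have [i||//] := simulateP xyp (X := X) (Y := Y) (t := b) (a := a) (Leaf false) _ _.
  by rewrite /misread (sb _ _ (gX i)) (sb _ _ (gY i)) !eqxx.
by rewrite !(sa _ _ (sab_mergeP _ fX fY fXY)).
Qed.

Lemma Rand0_sab_comp (A : ralg R symbol n) (B : ralg R bool k) (u v : R) :
  0 <= u -> 0 <= v -> correct_with 1 A (sab f) -> correct_with 1 B g ->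
  (forall q, q \in dom (sab f) -> (expected_queries A q <= u%:E)%E) ->
  (forall x, x \in dom g -> (expected_queries B x <= v%:E)%E) ->
  RS R (pf_comp f g) <= u * v.
Proof.
move=> u0 v0 /correct_with1 Ah /correct_with1 Bh Au Bv.
pose C := rbind A (fun a => rbind B (fun b => rret R (guarded_simulate a b))).
apply: (@Rand0_le _ _ _ C); last 1 first.
- move=> p; rewrite inE; case: (sab _ _) (@guarded_simulateP p) => // c.
  move=> /(_ c erefl)[x [q [gx fq ab]]] _.
  rewrite expected_queriesE mean_bind_ret => [|t]; last by rewrite lee_fin.
  apply: (@le_trans _ _ (mean A (fun a => (queries a q)%:R%:E * v%:E)%E)).
    apply: le_mean => a; first by apply: mean_ge0 => b; rewrite lee_fin.
    apply: le_trans (mean_path_sum (B := B) (w := fun b i => queries b (block x i)) _ _ _).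
      by apply: le_mean => b; rewrite lee_fin// ler_nat; case: (ab a b).
    by move=> i; rewrite -expected_queriesE; exact: Bv.
  rewrite meanZr => [||t]; rewrite ?lee_fin// EFinM.
  by rewrite lee_wpmul2r ?lee_fin// -expected_queriesE; exact: Au.
- apply/correct_with1/eqP; rewrite eq_le mean_bool_le1 /=.
  rewrite mean_bind_ret => [|t]; last by rewrite lee_fin.
  rewrite -Ah; apply: le_mean => a; first by rewrite lee_fin.
  case: (boolP (solves _ a)) => sa; last by apply: mean_ge0 => b; rewrite lee_fin.
  rewrite -[leLHS]Bh; apply: le_mean => b; rewrite lee_fin// ler_nat.
  case: (boolP (solves g b)) => // sb; rewrite lt0b.
  apply/solvesP => p c /guarded_simulateP[_ [_ [_ _ /(_ a b)[+ _]]]].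
  exact.
- exact: mulr_ge0.
Qed.

Lemma RS_comp_le : RS R (pf_comp f g) <= RS R f * Rand0 R g.
Proof.
have r0 : 0 <= RS R f := Rand0_ge0 _ _.
have M0 := Rand0_ge0 R g.
apply/ler_addgt0Pr => e e0.
(* Since [d <= 1], the product of the two costs, each increased by [d], grows by at most
   [d * (RS R f + Rand0 R g + 1) <= e]. *)
pose d : R := Num.min 1 (e / (RS R f + Rand0 R g + 1)).
have s0 : 0 < RS R f + Rand0 R g + 1 by lra.
have d0 : 0 < d by rewrite lt_min ltr01 divr_gt0.
have [A [Ah Au]] := Rand0_attain Star (sab f) d0.
have [B [Bh Bv]] := Rand0_attain true g d0.
apply: le_trans (Rand0_sab_comp _ _ Ah Bh Au Bv) _; [rewrite -/(RS R f); lra|lra|].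
have d1 : d <= 1 by rewrite ge_min lexx.
have : d * (RS R f + Rand0 R g + 1) <= e by rewrite -ler_pdivlMr// ge_min lexx orbT.
rewrite -/(RS R f); nra.
Qed.

End ZeroError.

(** * Error reduction by majority vote *)

Lemma mean_probN_le (R : realType) (S : finType) n (A : ralg R S n)
    (P : pred (dtree S n)) (c : R) :
  (c%:E <= mean A (fun t => (P t)%:R%:E))%E ->
  (mean A (fun t => (~~ P t)%:R%:E) <= (1 - c)%:E)%E.
Proof.
have := mean_probC A P.
case: (mean A _) => [r||] //; case: (mean A _) => [s||] //= [rs].
by rewrite !lee_fin; lra.
Qed.

Lemma mean_affine_le (R : realType) (S : finType) n (A : ralg R S n)
    (F : dtree S n -> R) (c k m : R) : 0 <= c -> 0 <= k -> (forall t, 0 <= F t) ->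
  (mean A (fun t => (F t)%:E) <= m%:E)%E ->
  (mean A (fun t => (c + k * F t)%:E) <= (c + k * m)%:E)%E.
Proof.
move=> c0 k0 F0 Fm.
under (@eq_mean _ _ _ A) => t do rewrite EFinD EFinM.
rewrite meanD => [||t]; [|by []|by rewrite mule_ge0 ?lee_fin].
rewrite mean_cst meanZl ?lee_fin// EFinD EFinM leeD2l// lee_wpmul2l// lee_fin//.
Qed.

Section Amplification.
Variables (R : realType) (S : finType) (n d : nat) (B : ralg R S n).

(* Majority vote of [m] further independent runs, [i] runs having already
   answered [true] and [j] having answered [false].  Drawing both continuations
   [t1] and [t0] keeps the recursion among distributions on single trees. *)
Fixpoint amplify (m i j : nat) : ralg R S n :=
  match m with
  | 0 => rret R (Leaf (j < i)%N)
  | m'.+1 => rbind B (fun u => rbind (amplify m' i.+1 j) (fun t1 =>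
      rbind (amplify m' i j.+1) (fun t0 =>
        rret R (graft (trunc d u) (fun o => if o then t1 else t0)))))
  end.

(** Excess queries count as failure, so a tree that does not fail keeps its right answer when
    truncated at [D]. *)
Definition fails (D : nat) (x : word S n) (v : bool) (t : dtree S n) : bool :=
  ~~ ((queries t x <= D)%N && (output t x == v)).

(* In expectation one vote multiplies the potential by at most
   2/3 * 3/4 + 1/3 * 4/3 = 17/18. *)
Definition vote_potential (v : bool) (i j : nat) : R :=
  if v then (4 / 3) ^+ j / (4 / 3) ^+ i else (4 / 3) ^+ i / (4 / 3) ^+ j.

Lemma mean_fails_amplify x v m i j :
  ((2 / 3)%:E <= mean B (fun u => (output (trunc d u) x == v)%:R%:E))%E ->
  (mean (amplify m i j) (fun t => (fails (m * d) x v t)%:R%:E) <=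
     ((17 / 18) ^+ m * vote_potential v i j)%:E)%E.
Proof.
move=> /mean_probN_le Bx.
have eqW (a b : R) : a = b -> a <= b by move=> ->.
have pos l : 0 < (4 / 3 : R) ^+ l by apply: exprn_gt0; lra.
have pot0 v' i' j' : 0 < vote_potential v' i' j'.
  by rewrite /vote_potential; case: v'; rewrite divr_gt0.
elim: m i j => [|m IH] i j.
  (* A wrong final answer means at least as many wrong votes as right ones, so the potential is at
     least 1. *)
  rewrite mean_ret expr0 mul1r /fails /= lee_fin.
  case: eqVneq => [_|]; first exact: ltW.
  rewrite /vote_potential; case: v {Bx} => /= [|]; rewrite ?eqb_id ?eqbF_neg ?negbK => ij;
    rewrite ler_pdivlMr ?mul1r// ler_weXn2l//; first [lra | by rewrite leqNgt | exact: ltnW].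
pose E i j := mean (amplify m i j) (fun t => (fails (m * d) x v t)%:R%:E).
rewrite /= mean_bind => [|t]; last by rewrite lee_fin.
(* A right vote multiplies the potential by 3/4, a wrong one by 4/3 = 3/4 + 7/12; with error at most
   1/3 the mean factor is 3/4 + 7/36 = 17/18. *)
apply: (@le_trans _ _ (mean B (fun u => ((17 / 18) ^+ m * vote_potential v i j * (3 / 4) +
    (17 / 18) ^+ m * vote_potential v i j * (7 / 12) * (~~ (output (trunc d u) x == v))%:R)%:E))).
  apply: le_mean => u.
    by apply: mean_ge0 => t; rewrite lee_fin.
  apply: (@le_trans _ _ (if output (trunc d u) x then E i.+1 j else E i j.+1)).
    rewrite mean_bind => [|t]; last by rewrite lee_fin.
    (* Only the continuation selected by the vote matters; the other one is integrated out as a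
       constant. *)
    have step t1 t0 : (fails (m.+1 * d) x v (graft (trunc d u) (fun o => if o then t1 else t0)) <=
        fails (m * d) x v (if output (trunc d u) x then t1 else t0))%N.
      rewrite /fails output_graft queries_graft.
      have := queries_trunc d u x; move: (if _ then _ else _) => t qu.
      case: (output t x == v); rewrite ?andbF// !andbT.
      case: (leqP (queries t x)) => qt; last exact: leq_b1.
      rewrite mulSn.
      by rewrite (leq_add qu qt).
    move: step; case: (output (trunc d u) x) => step.
      apply: le_mean => t1; first by apply: mean_ge0 => t; rewrite lee_fin.
      rewrite mean_bind => [|t]; last by rewrite lee_fin.
      rewrite -[leRHS](mean_cst (amplify m i j.+1)).
      apply: le_mean => t0; first by apply: mean_ge0 => t; rewrite lee_fin.
      by rewrite mean_ret lee_fin ler_nat step.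
    rewrite -[leRHS](mean_cst (amplify m i.+1 j)).
    apply: le_mean => t1; first by apply: mean_ge0 => t; rewrite lee_fin.
    rewrite mean_bind => [|t]; last by rewrite lee_fin.
    apply: le_mean => t0; first by apply: mean_ge0 => t; rewrite lee_fin.
    by rewrite mean_ret lee_fin ler_nat step.
  have -> : (if output (trunc d u) x then E i.+1 j else E i j.+1) =
     E (output (trunc d u) x + i)%N (~~ output (trunc d u) x + j)%N by case: ifP.
  apply: le_trans (IH _ _) _; rewrite lee_fin -!mulrA -mulrDr.
  apply: ler_wpM2l; first by apply: exprn_ge0; lra.
  rewrite -mulrDr /vote_potential.
  have := pos i; have := pos j.
  case: (output _ _); case: v {Bx E IH} => /=; rewrite ?exprS; set a := _ ^+ i;
    set b := _ ^+ j => b0 a0; rewrite ?invfM; apply: eqW; field; rewrite ?gt_eqF//.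
have q0 : 0 <= (17 / 18 : R) ^+ m by apply: exprn_ge0; lra.
have := pot0 v i j; move/ltW => p0.
have k0 c : 0 <= c -> 0 <= (17 / 18) ^+ m * vote_potential v i j * c.
  by move=> c0; apply: mulr_ge0 => //; apply: mulr_ge0.
apply: (le_trans (mean_affine_le _ _ _ Bx)) => [||u|]; last first.
- by rewrite lee_fin exprS; apply: eqW; field.
- by [].
- by apply: k0; lra.
- by apply: k0; lra.
Qed.

End Amplification.

(** * Composition with a bounded-error inner algorithm and a zero-error fallback *)

Section BoundedError.
Variables (R : realType) (n k : nat) (f : pfun bool n) (g : pfun bool k).
Variables (T D : nat) (A : ralg R symbol n) (B : ralg R bool k).
Variables (E : ralg R symbol (n * k)) (u v eps : R).
Hypotheses (u0 : 0 <= u) (v0 : 0 <= v) (eps0 : 0 <= eps) (T0 : (0 < T)%N).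
Hypothesis A_correct : correct_with 1 A (sab f).
Hypothesis A_cost :
  forall q, q \in dom (sab f) -> (expected_queries A q <= u%:E)%E.
Hypothesis B_error : forall x b, g x = Some b ->
  (mean B (fun t => (output (trunc D t) x != b)%:R%:E) <= eps%:E)%E.
Hypothesis E_correct : correct_with 1 E (sab (pf_comp f g)).
Hypothesis E_cost : forall p, p \in dom (sab (pf_comp f g)) ->
  (expected_queries E p <= v%:E)%E.
Hypothesis budget : 2 * u / T%:R + 2 * eps * T%:R <= 1 / 2.

Let T0R : 0 < T%:R :> R. Proof. by rewrite ltr0n. Qed.

Let sim a b e : dtree symbol (n * k) := simulate (trunc T a) (trunc D b) e.

(** The fallback is drawn independently of [a] and [b], so its mean cost multiplies the failure
    bound of the simulation. *)
Let C := rbind A (fun a => rbind B (fun b => rbind E (fun e => rret R (sim a b e)))).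

Let mean_C G : (forall t, 0 <= G t)%E ->
  mean C G = mean A (fun a => mean B (fun b => mean E (fun e => G (sim a b e)))).
Proof.
move=> G0; rewrite mean_bind//; apply: eq_mean => a.
exact: mean_bind_ret.
Qed.

(** Holds whatever [a] and [b] are: the simulation answers only what a sabotaged entry reveals, and
    otherwise [e] answers. *)
Let C_correct : correct_with 1 C (sab (pf_comp f g)).
Proof.
apply/correct_with1/eqP; rewrite eq_le mean_bool_le1 /=.
rewrite mean_C => [|t]; last by rewrite lee_fin.
rewrite -[leLHS](mean_cst A); apply: le_mean => // a.
rewrite -[leLHS](mean_cst B); apply: le_mean => // b.
have /correct_with1 <- := E_correct.
apply: le_mean => e; rewrite lee_fin// ler_nat.
case: solvesP => // se; rewrite lt0b; apply/solvesP => p c pc.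
have [x [y [X [Y [xyp _ _ _]]]]] := sab_comp_witness pc.
by have [[]//|[-> _ _]] := simulate_trunc xyp X Y T D a b e; exact: se.
Qed.

(* Dominates the indicator of the event that the simulation finds no sabotaged
   entry; the middle term is Markov's bound for [A] exceeding [T] queries. *)
Let miss (x y : word bool (n * k)) (X Y : word bool n) c a b : R :=
  ((~~ solves (sab f) a)%:R +
    T%:R^-1 * ((queries a (sab_merge X Y true))%:R +
               (queries a (sab_merge X Y false))%:R)) +
  (path_sum (trunc T a) (sab_merge X Y c) (misread x y X Y (trunc D b)))%:R.

(** If [e] is reached without a misreading, the truncated [a] does not separate the two merged
    words. So [a] is not solving or exceeds [T] queries on one of them, and [miss] is at least 1. *)
Let queries_sim x y X Y c p a b e : sabotaged x y c p ->
  X \in dom f -> Y \in dom f -> f X != f Y ->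
  (queries (sim a b e) p)%:R <=
    (T * D)%:R + miss x y X Y c a b * (queries e p)%:R.
Proof.
move=> xyp fX fY fXY.
have q0 (m : nat) : 0 <= m%:R :> R by [].
have Ti0 : 0 < T%:R^-1 :> R by rewrite invr_gt0.
have := simulate_trunc xyp X Y T D a b e.
rewrite /miss -/(sim a b e).
set ps := path_sum _ _ _.
move=> [[_ q1]|[_ q1 bad]].
  apply: (@le_trans _ _ (T * D)%:R); first by rewrite ler_nat.
  by rewrite lerDl mulr_ge0// !addr_ge0// mulr_ge0 ?addr_ge0// ltW.
apply: (@le_trans _ _ ((T * D)%:R + (queries e p)%:R)).
  by rewrite -natrD ler_nat.
rewrite lerD2l -[leLHS]mul1r ler_wpM2r//.
have [ps0|ps0] := posnP ps; last first.
  apply: (@le_trans _ _ ps%:R); first by rewrite ler1n.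
  by rewrite lerDr addr_ge0// mulr_ge0 ?addr_ge0// ltW.
case: bad => [|bad]; first by rewrite ps0.
rewrite ps0 addr0; case: solvesP => sa; last first.
  by rewrite lerDl mulr_ge0 ?addr_ge0// ltW.
rewrite add0r mulrC ler_pdivlMr// mul1r -natrD ler_nat.
have [qt|] := leqP (queries a (sab_merge X Y true)) T; last first.
  by move=> /ltnW /leq_trans; apply; exact: leq_addr.
have [qf|] := leqP (queries a (sab_merge X Y false)) T; last first.
  by move=> /ltnW /leq_trans; apply; exact: leq_addl.
by move: bad; rewrite !output_trunc// !(sa _ _ (sab_mergeP _ fX fY fXY)).
Qed.

(** Union bound: at most [T] calls, each misreading either of two blocks with probability at most
    [eps]. *)
Let mean_path_misread (x y : word bool (n * k)) (X Y : word bool n) c a :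
  (forall i, g (block x i) = Some (X i)) -> (forall i, g (block y i) = Some (Y i)) ->
  (mean B (fun b => (path_sum (trunc T a) (sab_merge X Y c)
     (misread x y X Y (trunc D b)))%:R%:E) <= (2 * eps * T%:R)%:E)%E.
Proof.
move=> gX gY.
apply: (@le_trans _ _ ((queries (trunc T a) (sab_merge X Y c))%:R%:E * (eps + eps)%:E)%E).
  apply: (@mean_path_sum _ _ _ _ _ B _ _ (fun b => misread x y X Y (trunc D b))) => i.
  rewrite EFinD /misread.
  under (@eq_mean _ _ _ B) => b do rewrite natrD EFinD.
  rewrite meanD => [||b]; rewrite ?lee_fin//.
  exact: leeD (B_error (gX i)) (B_error (gY i)).
rewrite -EFinM lee_fin -mulr2n -(mulr_natl eps) [leLHS]mulrC ler_wpM2l ?mulr_ge0//.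
by rewrite ler_nat queries_trunc.
Qed.

(** Averaging over [e], then [b], then [a] bounds the mean of [miss] by [2 * u / T%:R] (Markov on
    two words) plus [2 * eps * T%:R] (misreadings), which [budget] keeps below 1/2. *)
Lemma RS_comp_le_half : RS R (pf_comp f g) <= (T * D)%:R + v / 2.
Proof.
apply: (Rand0_le C_correct) => [|p pd]; first by rewrite addr_ge0// divr_ge0.
have : p \in dom (sab (pf_comp f g)) by [].
rewrite inE; case pc: (sab _ _) => [c|//] _.
have [x [y [X [Y [xyp gX gY [fX fY fXY]]]]]] := sab_comp_witness pc.
rewrite expected_queriesE mean_C => [|t]; last by rewrite lee_fin.
have Ti0 : 0 <= T%:R^-1 :> R by rewrite invr_ge0 ltW.
pose N a : R := (~~ solves (sab f) a)%:R +
    T%:R^-1 * ((queries a (sab_merge X Y true))%:R +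
               (queries a (sab_merge X Y false))%:R).
have N0 a : 0 <= N a by rewrite addr_ge0// mulr_ge0// addr_ge0.
pose TD : R := (T * D)%:R.
have TD0 : 0 <= TD by [].
have e2 : 0 <= 2 * eps * T%:R by rewrite !mulr_ge0// ltW.
have stepE a b : (mean E (fun e => (queries (sim a b e) p)%:R%:E) <=
    (TD + miss x y X Y c a b * v)%:E)%E.
  have m0 : 0 <= miss x y X Y c a b by rewrite addr_ge0//; exact: N0.
  apply: le_trans (mean_affine_le (A := E) (F := fun e => (queries e p)%:R) _ _ _ _) => //.
    apply: le_mean => e; rewrite lee_fin//; exact: queries_sim.
  by rewrite -expected_queriesE; exact: E_cost.
have stepB a : (mean B (fun b => mean E (fun e => (queries (sim a b e) p)%:R%:E)) <=
    (TD + v * (2 * eps * T%:R) + v * N a)%:E)%E.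
  rewrite addrAC.
  apply: le_trans (mean_affine_le _ _ _ (mean_path_misread c a gX gY)) => //.
  - apply: le_mean => b; first by apply: mean_ge0 => e; rewrite lee_fin.
    apply: le_trans (stepE a b) _; rewrite lee_fin /miss -/(N a).
    by rewrite mulrC mulrDr addrA.
  - by rewrite addr_ge0// mulr_ge0.
apply: (@le_trans _ _ (TD + v * (2 * eps * T%:R) + v * (T%:R^-1 * (u + u)))%:E).
  apply: le_trans (mean_affine_le (A := A) (F := N) _ _ _ _) => //.
  - apply: le_mean => a; last exact: stepB.
    by apply: mean_ge0 => b; apply: mean_ge0 => e; rewrite lee_fin.
  - by rewrite addr_ge0// mulr_ge0.
  - under (@eq_mean _ _ _ A) => a do rewrite /N EFinD EFinM EFinD.
    have qq q : (0 <= (queries q (sab_merge X Y true))%:R%:E +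
        (queries q (sab_merge X Y false))%:R%:E :> \bar R)%E by rewrite adde_ge0 ?lee_fin.
    rewrite meanD => [||t]; [|by []|by rewrite mule_ge0 ?lee_fin].
    have /correct_with1/mean_sureC -> := A_correct.
    rewrite add0e meanZl ?lee_fin// EFinM lee_wpmul2l ?lee_fin//.
    rewrite meanD ?EFinD => [||t]; rewrite ?lee_fin//.
    by apply: leeD; rewrite -expected_queriesE; apply: A_cost;
      rewrite inE (sab_mergeP _ fX fY fXY).
rewrite lee_fin -addrA lerD2l -mulrDr ler_wpM2l//.
by move: budget; lra.
Qed.

End BoundedError.

(** * Choice of parameters for the logarithmic bound *)

Lemma pow2_log2 (R : realType) (r : R) : 1 <= r ->
  exists j : nat, r <= 2 ^+ j /\ j%:R <= log2 r + 1.
Proof.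
move=> r1; have r0 : 0 < r by lra.
have ln2 : 0 < ln (2 : R) by apply: ln_gt0; lra.
have l0 : 0 <= log2 r by apply: divr_ge0; [exact: ln_ge0|exact: ltW].
have /andP[lo hi] := truncn_itv l0.
exists (Num.truncn (log2 r)).+1; split; last by rewrite -addn1 natrD lerD2r lo.
rewrite -ler_ln ?posrE ?exprn_gt0// lnXn// -(mulr_natl (ln 2)).
by rewrite -ler_pdivrMr// ltW.
Qed.

Lemma amplify_correct (R : realType) (S : finType) n (h : pfun S n) d
    (B : ralg R S n) m x b :
  correct_with (2 / 3) B h -> worst_case_le B h d -> h x = Some b ->
  (mean (amplify d B m 0 0) (fun t => (output (trunc (m * d) t) x != b)%:R%:E) <=
     ((17 / 18) ^+ m)%:E)%E.
Proof.
move=> /correct_withE Bh Bd hx.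
have /(@mean_fails_amplify R S n d B x b m 0 0) :
    ((2 / 3)%:E <= mean B (fun u => (output (trunc d u) x == b)%:R%:E))%E.
  have q1 : mean B (fun t => (queries t x <= d)%N%:R%:E) = 1%E.
    by rewrite mean_prob; apply: Bd; rewrite inE hx.
  apply: (le_trans (Bh _ _ hx)); apply: (le_trans (mean_le_sure _ q1)).
  apply: le_mean => u; rewrite lee_fin// ler_nat.
  case: (leqP (queries u x)) => qd; last by rewrite andbF.
  by rewrite andbT output_trunc.
rewrite (_ : vote_potential _ _ _ _ = 1) ?mulr1; last first.
  by case: (b); rewrite /vote_potential !expr0 divr1.
apply: le_trans; apply: le_mean => t; rewrite lee_fin// ler_nat /fails.
case: (leqP (queries t x)) => //= qd; last by case: (_ != _).
by rewrite output_trunc.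
Qed.

Lemma RS_comp_le_log (R : realType) n k (f : pfun bool n) (g : pfun bool k) :
  RS R (pf_comp f g) <=
    8840 * (RS R f * Rand R g * Num.max 1 (log2 (RS R f))).
Proof.
(* Without sabotaged inputs the left side is at most 0. Otherwise [RS R f] and [Rand R g] are at
   least 1, which absorbs the additive constants below. *)
have [[p pd]|nosab] := pselect (exists p, p \in dom (sab (pf_comp f g))); last first.
  have [A [Ah _]] := exact_alg R Star (sab (pf_comp f g)).
  apply: (@le_trans _ _ 0).
    by apply: (Rand0_le Ah) => // p pd; case: nosab; exists p.
  apply: mulr_ge0; first exact: ler0n.
  apply: mulr_ge0; first by rewrite mulr_ge0 ?Rand0_ge0// (Rand_ge0 R true).
  by rewrite le_max ler01.
move: pd; rewrite inE; case pc: (sab _ _) => [c|//] _.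
have [x [y [X [Y [_ gX gY [fX fY fXY]]]]]] := sab_comp_witness pc.
have r1 := sab_lower_bound R fX fY fXY.
have g1 : 1 <= Rand R g.
  have [i XYi] : exists i, X i != Y i.
    apply/existsP; apply: contraR fXY => /existsPn XY.
    by rewrite (_ : X = Y)//; apply/ffunP => i; apply/eqP/negPn.
  by apply: (@Rand_ge1 R _ _ true g (block x i) (block y i)); rewrite ?inE ?gX ?gY ?(inj_eq Some_inj).
have [A [Ah Aq]] := Rand0_attain Star (sab f) (ltr01 : 0 < 1 :> R).
rewrite -/(RS R f) in Aq.
have [d [B [Bh Bd d_le]]] := @Rand_attain R _ _ true g 1 ltr01.
have [j [rj jL]] := pow2_log2 r1.
set r := RS R f in r1 Aq rj jL *; set M := Rand R g in g1 d_le *.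
set L := Num.max 1 (log2 r).
have L1 : 1 <= L by rewrite le_max lexx.
have lL : log2 r <= L by rewrite le_max lexx orbT.
have r16 : 0 <= 16 * r by lra.
have /andP[Tlo Thi] := truncn_itv r16.
(* Then [(r + 1) / T%:R <= 2 * r / (16 * r) = 1 / 8], so the Markov term takes 1/4 of the budget. *)
pose T := (Num.truncn (16 * r)).+1.
have T_lo : 16 * r <= T%:R by exact: ltW.
have T_hi : T%:R <= 17 * r by rewrite /T -addn1 natrD; lra.
have T0 : 0 < T%:R :> R by lra.
(* Each 13 votes halve the error bound, and [2 ^+ J >= 256 * r >= 8 * T%:R]; thus
   [2 * eps * T%:R <= 1 / 4]. *)
pose J := (8 + j)%N; pose m := (13 * J)%N.
pose eps : R := (17 / 18) ^+ m.
have eps0 : 0 <= eps by apply: exprn_ge0; lra.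
have eps_le : eps * (8 * T%:R) <= 1.
  have half : (17 / 18 : R) ^+ 13 <= 2^-1 by rewrite !exprS expr0; lra.
  have : eps <= (2 ^+ J)^-1.
    rewrite /eps /m exprM -exprVn; apply: lerXn2r => //; rewrite nnegrE.
      by apply: exprn_ge0; lra.
    by rewrite invr_ge0.
  have TJ : 8 * T%:R <= 2 ^+ J :> R.
    by rewrite /J exprD !exprS expr0; lra.
  have J0 : 0 < 2 ^+ J :> R by apply: exprn_gt0.
  move=> /(ler_wpM2r (ltW J0)); rewrite mulVf ?gt_eqF//.
  by apply: le_trans; apply: ler_wpM2l.
have TD : (T * (m * d))%:R <= 4420 * (r * M * L) :> R.
  rewrite !natrM.
  have J_le : J%:R <= 10 * L :> R by rewrite /J natrD; lra.
  have d_le2 : d%:R <= 2 * M by lra.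
  (* The constant 4420 is 17 * 13 * 10 * 2. *)
  apply: (@le_trans _ _ (17 * r * (13 * (10 * L) * (2 * M)))); last by lra.
  by rewrite !ler_pM ?mulr_ge0//.
(* Solving for [RS R (pf_comp f g)] doubles 4420 to 8840. *)
suff : RS R (pf_comp f g) <= (T * (m * d))%:R + RS R (pf_comp f g) / 2 by lra.
apply/ler_addgt0Pr => e e0.
have [E [Eh Eq]] := Rand0_attain Star (sab (pf_comp f g)) e0.
rewrite -/(RS _ _) in Eq.
have RS0 : 0 <= RS R (pf_comp f g) := Rand0_ge0 _ _.
apply: (@le_trans _ _ ((T * (m * d))%:R + (RS R (pf_comp f g) + e) / 2)); last by lra.
apply: (@RS_comp_le_half _ _ _ f g T (m * d) A (amplify d B m 0 0) E (r + 1) _ eps) => //.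
- lra.
- by move=> z b; apply: amplify_correct.
have : (r + 1) / T%:R <= 1 / 8.
  by rewrite ler_pdivrMr//; lra.
by lra.
Qed.

Theorem theorem24 (R : realType) :
  (forall (n k : nat) (f : pfun bool n) (g : pfun bool k),
     RS R (pf_comp f g) <= RS R f * Rand0 R g) /\
  (exists C : R, 0 < C /\
     forall (n k : nat) (f : pfun bool n) (g : pfun bool k),
       RS R (pf_comp f g) <=
         C * (RS R f * Rand R g * Num.max 1 (log2 (RS R f)))).
Proof.
split; first exact: RS_comp_le.
by exists 8840; split => [|n k f g]; [lra|exact: RS_comp_le_log].
Qed.
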